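(* Let $F:\mathbb{N}^+\times\mathbb{N}^+\to\mathbb{N}^+$ be defined by $$F(m,n)=\frac{1}{4}\left[(m+n-1)^2-\big((m+n-1)\bmod 2\big)\right]+\min(m,n).$$ Let $S_O=\{(x,y)\in\mathbb{N}^+\times\mathbb{N}^+ : x\ge y\}$. Then the restriction of $F$ to $S_O$ is an injection from $S_O$ to $\mathbb{N}^+$.
   Context: $\mathbb{N}^+$ denotes the set of positive integers. For an integer $k$, $k\bmod 2$ denotes the least non-negative residue of $k$ modulo $2$. In the paper, $S_O$ is regarded as an ordered set (pairs ordered first by increasing $x+y$, then by increasing $y$), but the ordering is irrelevant to this statement. *)

(* Defs.v *)
From mathcomp Require Import all_boot all_order all_algebra.
From mathcomp Require Import zify ring.

Set Implicit Arguments.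
Unset Strict Implicit.
Unset Printing Implicit Defensive.

Import GRing.Theory.

Definition posnat : Type := {n : nat | 0 < n}.

(* The truncated subtractions and the Euclidean quotient by 4 are exact here:
   see [F_ratE]. *)
Definition F_nat (m n : nat) : nat :=
  ((m + n - 1) ^ 2 - (m + n - 1) %% 2) %/ 4 + minn m n.

Lemma F_nat_gt0 (m n : nat) : 0 < m -> 0 < n -> 0 < F_nat m n.
Proof. by move=> m0 n0; rewrite addn_gt0 leq_min m0 n0 orbT. Qed.

Definition F (p : posnat * posnat) : posnat :=
  exist _ (F_nat (sval p.1) (sval p.2))
    (F_nat_gt0 (svalP p.1) (svalP p.2)).

Lemma F_nat_exact (k : nat) : (k ^ 2 - k %% 2) %/ 4 * 4 + k %% 2 = k ^ 2.
Proof.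
rewrite {1 3 4}(divn_eq k 2); set q := k %/ 2; rewrite modnMDl modn_mod.
have : k %% 2 < 2 by rewrite ltn_mod.
case: (k %% 2) => [|[|//]] _.
- by rewrite subn0 !addn0 expnMn mulnK.
- by rewrite (_ : (q * 2 + 1) ^ 2 = (q * q + q) * 4 + 1) ?addnK ?mulnK //; lia.
Qed.

(* The defining formula, with genuine subtraction, division and integer
   residue. *)
Lemma F_ratE (m n : posnat) :
  ((sval (F (m, n)))%:Q =
     1 / 4 * (((sval m)%:Q + (sval n)%:Q - 1) ^+ 2
              - (((sval m)%:Z + (sval n)%:Z - 1) %% 2)%Z%:Q)
     + (minn (sval m) (sval n))%:Q)%R.
Proof.
case: m n => m m0 [n n0] /=; rewrite /F_nat.
have -> : (m%:Z + n%:Z - 1 = (m + n - 1)%N%:Z)%R by lia.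
have -> : (m%:Q + n%:Q - 1 = (m + n - 1)%N%:Q)%R.
  by rewrite -!pmulrn natrB ?natrD //; lia.
rewrite modz_nat; move: (m + n - 1) => k.
rewrite -!pmulrn natrD -natrX -{2}(F_nat_exact k) natrD natrM.
by field.
Qed.

Definition S_O : {pred posnat * posnat} := [pred p | sval p.2 <= sval p.1].

(* Main.v *)
(* Put k = m + n - 1 and G(k) = (k^2 - k mod 2) / 4, so that F(m, n) = G(k) + n
   on S_O.  There 1 <= n <= (k + 1) / 2, and G(k + 1) - G(k) is the integer part
   of (k + 1) / 2, so F(m, n) lies in the interval ]G(k), G(k + 1)].  These
   intervals are disjoint, hence F(m, n) determines k, then n, then m. *)
Require Import Defs.
From mathcomp Require Import all_boot.
From mathcomp Require Import zify.

(** Disjointness of the intervals, in the form G(k) + n <= G(k') < G(k') + n' for k < k'. *)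
Lemma F_nat_lt (m n m' n' : nat) :
  n <= m -> 0 < n' -> n' <= m' -> m + n < m' + n' -> F_nat m n < F_nat m' n'.
Proof.
move=> le_nm n'_gt0 le_n'm' lt_sum.
rewrite /F_nat (minn_idPr le_nm) (minn_idPr le_n'm').
have := F_nat_exact (m + n - 1); have := F_nat_exact (m' + n' - 1).
have : (m + n - 1 + 1) ^ 2 <= (m' + n' - 1) ^ 2 by rewrite leq_exp2r //; lia.
(* As 2n <= k + 1 and residues mod 2 are at most 1, the squares give 4 G(k') >= 4 (G(k) + n) - 2;
   integrality absorbs the 2. *)
rewrite sqrnD; lia.
Qed.

Lemma F_nat_inj (m n m' n' : nat) :
  0 < n -> n <= m -> 0 < n' -> n' <= m' ->
  F_nat m n = F_nat m' n' -> m = m' /\ n = n'.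
Proof.
move=> n_gt0 le_nm n'_gt0 le_n'm' eqF.
case: (ltngtP (m + n) (m' + n')) => [lt_sum|gt_sum|eq_sum].
- by have := F_nat_lt _ _ _ _ le_nm n'_gt0 le_n'm' lt_sum; rewrite eqF ltnn.
- by have := F_nat_lt _ _ _ _ le_n'm' n_gt0 le_nm gt_sum; rewrite eqF ltnn.
move: eqF; rewrite /F_nat (minn_idPr le_nm) (minn_idPr le_n'm') eq_sum.
by move/addnI=> eq_n; split=> //; lia.
Qed.

Theorem theorem1 : {in S_O &, injective F}.
Proof.
move=> [[m m_gt0] [n n_gt0]] [[m' m'_gt0] [n' n'_gt0]].
rewrite !inE /= => le_nm le_n'm' [eqF].
have [eq_m eq_n] := F_nat_inj _ _ _ _ n_gt0 le_nm n'_gt0 le_n'm' eqF.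
(* Positivity is a boolean condition, so its proofs do not distinguish elements of [posnat]. *)
by congr (_, _); apply: val_inj.
Qed.
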